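(* Let $d,L$ be positive integers and let $w,v$ be type sequences having the same number of occurrences of `$+$' and the same number of occurrences of `$-$'. There is a bijection $\Psi_{w,v}$ from skew $(d,L)$-cylindric row-strict $w$-oscillating tableaux to skew $(d,L)$-cylindric row-strict $v$-oscillating tableaux that preserves inner shape, outer shape, $\mathrm{wt}^+$ and $\mathrm{wt}^-$, and commutes with reversal: $\Psi_{w^*,v^*}(T^{\mathrm{rev}})=\Psi_{w,v}(T)^{\mathrm{rev}}$ for all such $T$, where $u^*$ denotes $u$ reversed with `$+$' and `$-$' interchanged.
   Context: A $d$-staircase is an integer sequence $\lambda=(\lambda_1\ge\cdots\ge\lambda_d)$ (entries may be negative), $|\lambda|=\sum\lambda_i$; it is a $(d,L)$-staircase if $\lambda_1-\lambda_d\le L$. For $d$-staircases, $\lambda\prec'_{(d,L)}\mu$ means both are $(d,L)$-staircases and $\mu_i-\lambda_i\in\{0,1\}$ for all $1\le i\le d$. For $w=w_1\cdots w_k$, a skew $(d,L)$-cylindric row-strict $w$-oscillating tableau is a sequence of $d$-staircases $T=(\lambda^{(0)},\ldots,\lambda^{(k)})$ with $\lambda^{(i-1)}\prec'_{(d,L)}\lambda^{(i)}$ if $w_i=+$ and $\lambda^{(i)}\prec'_{(d,L)}\lambda^{(i-1)}$ if $w_i=-$. Its inner shape is $\lambda^{(0)}$, outer shape $\lambda^{(k)}$; $\mathrm{wt}^+(T)_i=|\lambda^{(a_i)}|-|\lambda^{(a_i-1)}|$ with $a_i$ the index of the $i$-th `$+$' in $w$; $\mathrm{wt}^-(T)_i=|\lambda^{(b_i-1)}|-|\lambda^{(b_i)}|$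 with $b_i$ the index of the $i$-th-to-last `$-$' in $w$. The reversal $T^{\mathrm{rev}}=(\lambda^{(k)},\ldots,\lambda^{(0)})$ is such a tableau of type $w^*$. *)

(* Defs.v *)
From mathcomp Require Import all_boot all_order all_algebra.
Set Implicit Arguments. Unset Strict Implicit. Unset Printing Implicit Defensive.
Import Order.TTheory GRing.Theory Num.Theory.
Local Open Scope ring_scope.

(* Type sequences: true = '+', false = '-'. *)
Definition tword := seq bool.

Definition staircase (d : nat) (l : seq int) : bool :=
  (size l == d) && sorted (fun a b : int => b <= a) l.

Definition stsize (l : seq int) : int := \sum_(x <- l) x.

Definition dL_staircase (d L : nat) (l : seq int) : bool :=
  staircase d l && (nth 0 l 0 - nth 0 l d.-1 <= L%:Z).

Definition precdL (d L : nat) (l m : seq int) : bool :=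
  [&& dL_staircase d L l, dL_staircase d L m &
      all2 (fun a b : int => (b - a == 0) || (b - a == 1)) l m].

(* Skew (d,L)-cylindric row-strict w-oscillating tableau, represented by the
   sequence (lambda^(0), ..., lambda^(k)) of its staircases. *)
Definition is_tableau (d L : nat) (w : tword) (T : seq (seq int)) : Prop :=
  size T = (size w).+1 /\
  (forall i, (i < size T)%N -> staircase d (nth [::] T i)) /\
  (forall i, (i < size w)%N ->
     if nth false w i
     then precdL d L (nth [::] T i) (nth [::] T i.+1)
     else precdL d L (nth [::] T i.+1) (nth [::] T i)).

Definition inner_shape (T : seq (seq int)) : seq int := nth [::] T 0.
Definition outer_shape (T : seq (seq int)) : seq int := last [::] T.

(* wt^+(T)_i = |lambda^(a_i)| - |lambda^(a_i - 1)|, a_i = position (1-based)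
   of the i-th '+'; 0-based position j gives a_i = j+1. *)
Definition wt_plus (w : tword) (T : seq (seq int)) : seq int :=
  [seq stsize (nth [::] T j.+1) - stsize (nth [::] T j)
  | j <- iota 0 (size w) & nth false w j].

(* wt^-(T)_i = |lambda^(b_i - 1)| - |lambda^(b_i)|, b_i = position of the
   i-th-to-last '-' (hence the reversal). *)
Definition wt_minus (w : tword) (T : seq (seq int)) : seq int :=
  rev [seq stsize (nth [::] T j) - stsize (nth [::] T j.+1)
      | j <- iota 0 (size w) & ~~ nth false w j].

Definition tstar (w : tword) : tword := rev (map negb w).

Definition trev (T : seq (seq int)) : seq (seq int) := rev T.

(* Main.v *)
(* A (d,L)-staircase extends to a weakly decreasing function on Z with
   f (z + d) = f z - L. For fixed lambda and nu, let sigma reverse each maximal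
   interval of Z on which both are constant; these are finite because L > 0.
   Then x |-> lambda + nu - x o sigma is an involution exchanging the mu with
   lambda < mu > nu and the kappa with lambda > kappa < nu (< being one vertical
   strip). It satisfies |mu| + |kappa| = |lambda| + |nu| and is symmetric in
   lambda and nu. This swaps two adjacent letters of the type w. Distinct
   swaps of a factor +- into -+ act on disjoint parts of the tableau and commute,
   so sorting w into -...-+...+ gives a result independent of the order of the
   swaps, and hence compatible with reversal. Psi sorts w and unsorts to v. *)

Require Import Defs.
From mathcomp Require Import all_boot all_order all_algebra.
From mathcomp Require Import zify.
Set Implicit Arguments. Unset Strict Implicit. Unset Printing Implicit Defensive.
Import Order.TTheory GRing.Theory Num.Theory.
Local Open Scope ring_scope.

(** * Staircases as quasi-periodic functions *)

Definition quasi_periodic (d L : nat) (f : int -> int) : Prop :=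
  forall z, f (z + d%:Z) = f z - L%:Z.

Definition antitone (f : int -> int) : Prop := forall z, f (z + 1) <= f z.

Lemma quasi_periodicM d L f : quasi_periodic d L f ->
  forall z k : int, f (z + k * d%:Z) = f z - k * L%:Z.
Proof.
move=> qf z; elim/int_ind => [|n IH|n IH].
- by rewrite !mul0r addr0 subr0.
- have -> : z + n.+1%:Z * d%:Z = z + n%:Z * d%:Z + d%:Z by nia.
  rewrite qf IH; lia.
- have E := qf (z + - n.+1%:Z * d%:Z).
  rewrite (_ : _ + d%:Z = z + - n%:Z * d%:Z) in E; last by lia.
  rewrite IH !mulNr !opprK in E *; lia.
Qed.

Lemma int_divn_eq d z : (0 < d)%N ->
  exists2 r : nat, (r < d)%N & exists k : int, z = r%:Z + k * d%:Z.
Proof.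
move=> d0; exists `|(z %% d%:Z)%Z|%N.
  have := ltz_pmod z (_ : 0 < d%:Z); have := modz_ge0 z (_ : d%:Z != 0); lia.
exists (z %/ d%:Z)%Z.
have := modz_ge0 z (_ : d%:Z != 0); have := divz_eq z d%:Z; lia.
Qed.

Lemma quasi_periodic_eq d L f g : (0 < d)%N ->
  quasi_periodic d L f -> quasi_periodic d L g ->
  (forall i : nat, (i < d)%N -> f i%:Z = g i%:Z) -> f =1 g.
Proof.
move=> d0 qf qg fg z; have [r rd [k ->]] := int_divn_eq z d0.
by rewrite (quasi_periodicM qf) (quasi_periodicM qg) fg.
Qed.

Lemma antitone_le f : antitone f -> forall a b, a <= b -> f b <= f a.
Proof.
move=> af a b ab; have -> : b = a + `|b - a|%N%:Z by lia.
elim: `|b - a|%N => [|n IH]; first by rewrite addr0.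
have := af (a + n%:Z); have -> : a + n%:Z + 1 = a + n.+1%:Z by lia.
lia.
Qed.

Definition ext (d L : nat) (l : seq int) (z : int) : int :=
  nth 0 l `|(z %% d%:Z)%Z|%N - (z %/ d%:Z)%Z * L%:Z.

Lemma ext_nat d L l i : (i < d)%N -> ext d L l i%:Z = nth 0 l i.
Proof.
move=> id; rewrite /ext modz_small ?divz_small; try lia.
by rewrite mul0r subr0.
Qed.

Lemma ext_quasi_periodic d L l : (0 < d)%N -> quasi_periodic d L (ext d L l).
Proof.
move=> d0 z; rewrite /ext modzDr divzDr ?dvdzz // divzz.
have -> : (d%:Z != 0) by lia.
lia.
Qed.

Lemma ext_mkseq d L f : (0 < d)%N -> quasi_periodic d L f ->
  ext d L (mkseq (fun i => f i%:Z) d) =1 f.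
Proof.
move=> d0 qf; apply: (quasi_periodic_eq d0 _ qf) => [|i id].
  exact: ext_quasi_periodic.
by rewrite ext_nat // nth_mkseq.
Qed.

(** The bound on the first entry minus the last is monotonicity at the seam: the extension takes at
    [d] the value of the first entry lowered by [L], to be compared with the last entry at
    [d.-1]. *)
Lemma dL_staircaseP d L l : (0 < d)%N ->
  dL_staircase d L l <-> size l = d /\ antitone (ext d L l).
Proof.
move=> d0; have qe := ext_quasi_periodic L l d0; split.
  case/andP=> /andP [/eqP sl so] lb; split=> // z.
  have [r rd [k ->]] := int_divn_eq z d0.
  have -> : r%:Z + k * d%:Z + 1 = r.+1%:Z + k * d%:Z by lia.
  rewrite !(quasi_periodicM qe).
  suff: ext d L l r.+1%:Z <= ext d L l r%:Z by lia.
  have [rd1|rd1] := ltnP r.+1 d.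
    rewrite !ext_nat //; move/sortedP: so => /(_ 0 r); apply; by rewrite sl.
  have er : r.+1 = d by lia.
  have -> : r.+1%:Z = 0%:Z + d%:Z by lia.
  rewrite qe !ext_nat // (_ : r = d.-1) ; [lia | by rewrite -er].
case=> sl al; apply/andP; split.
  rewrite /staircase sl eqxx /=; apply/(sortedP 0) => i; rewrite sl => id.
  have := al i%:Z; have -> : i%:Z + 1 = i.+1%:Z by lia.
  by rewrite !ext_nat //; lia.
have := al d.-1%:Z; have -> : d.-1%:Z + 1 = 0%:Z + d%:Z by lia.
rewrite qe !ext_nat; lia.
Qed.

(** Both extensions drop by the same [L] over a period, so their difference is [d]-periodic and one
    period decides. *)
Lemma precdLP d L l m : (0 < d)%N ->
  precdL d L l m <->
  [/\ dL_staircase d L l, dL_staircase d L m &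
      forall z, 0 <= ext d L m z - ext d L l z <= 1].
Proof.
move=> d0; split.
  case/and3P=> sl sm; rewrite all2E => /andP [/eqP slm /allP H].
  split=> // z; have [sld _] := (dL_staircaseP L l d0).1 sl.
  have [r rd [k ->]] := int_divn_eq z d0.
  rewrite !(quasi_periodicM (ext_quasi_periodic L _ d0)) !ext_nat //.
  have := H (nth 0 l r, nth 0 m r); rewrite -nth_zip // mem_nth; last first.
    by rewrite size_zip -slm minnn sld.
  move=> /(_ isT); rewrite nth_zip ?sld -?slm ?sld //= => Hr; lia.
case=> sl sm H; apply/and3P; split=> //.
have [sld _] := (dL_staircaseP L l d0).1 sl.
have [smd _] := (dL_staircaseP L m d0).1 sm.
rewrite all2E sld smd eqxx /=; apply/(all_nthP (0, 0)) => i.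
rewrite size_zip sld smd minnn => id.
rewrite nth_zip ?sld ?smd //=.
have := H i%:Z; rewrite !ext_nat // => Hr.
move: (nth _ l _) (nth _ m _) Hr => a b; lia.
Qed.

Lemma stsize_ext d L l : size l = d -> stsize l = \sum_(i < d) ext d L l i%:Z.
Proof.
move=> <-; rewrite /stsize (big_nth 0) big_mkord; apply: eq_bigr => i _.
by rewrite ext_nat.
Qed.

(** As [p] is closed downwards, its first failure separates where it holds from where it fails; the
    failure at [n] guarantees that the search meets it. *)
Lemma ltn_find_iota (p : pred nat) n :
  (forall t, p t.+1 -> p t) -> ~~ p n ->
  forall t, (t < find (predC p) (iota 0 n.+1))%N = p t.
Proof.
move=> pS pn t; set u := find _ _.
have hu : has (predC p) (iota 0 n.+1).
  by apply/hasP; exists n => //; rewrite mem_iota; lia.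
have un : (u < n.+1)%N by rewrite -[X in (_ < X)%N](size_iota 0) -has_find.
have pW a : forall b, (a <= b)%N -> p b -> p a.
  elim=> [|b IH]; first by rewrite leqn0 => /eqP ->.
  rewrite leq_eqVlt => /orP [/eqP -> //|ab /pS]; exact: IH.
have [tu|ut] := ltnP t u.
  have := before_find 0%N tu; rewrite nth_iota; last by lia.
  by move/negbT; rewrite /= negbK add0n => ->.
apply/esym/negbTE/negP => pt; have := nth_find 0%N hu.
by rewrite -/u nth_iota //= add0n (pW _ _ ut pt).
Qed.

(** * The local rule *)

Definition same_block (f g : int -> int) (i j : int) : bool :=
  (f i == f j) && (g i == g j).

(** Counts the positions of the block of [i] to the right of [i]. Searching [d] positions suffices
    when [0 < L], since [f (i + d)] is then [f i - L], which differs from [f i]. *)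
Definition block_up (d : nat) (f g : int -> int) (i : int) : nat :=
  find (predC (fun t : nat => same_block f g i (i + t.+1%:Z))) (iota 0 d).

Definition block_down (d : nat) (f g : int -> int) (i : int) : nat :=
  find (predC (fun t : nat => same_block f g i (i - t.+1%:Z))) (iota 0 d).

(* Reverses each maximal interval on which both [f] and [g] are constant. *)
Definition block_rev (d : nat) (f g : int -> int) (i : int) : int :=
  i + (block_up d f g i)%:Z - (block_down d f g i)%:Z.

Lemma block_revC d f g : block_rev d f g =1 block_rev d g f.
Proof.
move=> i; rewrite /block_rev /block_up /block_down.
by congr (_ + _%:Z - _%:Z); apply: eq_find => t /=; rewrite /same_block andbC.
Qed.

Lemma block_revD d L f g : quasi_periodic d L f -> quasi_periodic d L g ->
  forall z, block_rev d f g (z + d%:Z) = block_rev d f g z + d%:Z.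
Proof.
move=> qf qg z; rewrite /block_rev.
have -> : block_up d f g (z + d%:Z) = block_up d f g z.
  apply: eq_find => t /=; rewrite /same_block.
  rewrite (_ : z + d%:Z + t.+1%:Z = z + t.+1%:Z + d%:Z); last by lia.
  by rewrite !qf !qg; lia.
have -> : block_down d f g (z + d%:Z) = block_down d f g z.
  apply: eq_find => t /=; rewrite /same_block.
  rewrite (_ : z + d%:Z - t.+1%:Z = z - t.+1%:Z + d%:Z); last by lia.
  by rewrite !qf !qg; lia.
lia.
Qed.

(** Blocks are intervals because antitone functions that agree at two points agree in between, and
    they are finite because [f] drops by [L > 0] over [d] steps. *)
Lemma same_blockP d L f g : (0 < d)%N -> (0 < L)%N ->
  quasi_periodic d L f -> antitone f -> antitone g ->
  forall i j, same_block f g i j =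
    (i - (block_down d f g i)%:Z <= j <= i + (block_up d f g i)%:Z).
Proof.
move=> d0 L0 qf af ag i j.
have af' := antitone_le af; have ag' := antitone_le ag.
have upP t : (t < block_up d f g i)%N = same_block f g i (i + t.+1%:Z).
  (* [ltn_find_iota] is used with [n := d.-1], which stands for position [i + d], outside the
     block. *)
  rewrite /block_up -{1}(prednK d0).
  apply: (@ltn_find_iota (fun t => same_block f g i (i + t.+1%:Z))) => [{}t|].
    rewrite /same_block.
    have := af' i (i + t.+1%:Z); have := af' (i + t.+1%:Z) (i + t.+2%:Z).
    have := ag' i (i + t.+1%:Z); have := ag' (i + t.+1%:Z) (i + t.+2%:Z).
    lia.
  by rewrite prednK // /same_block qf; lia.
have dnP t : (t < block_down d f g i)%N = same_block f g i (i - t.+1%:Z).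
  rewrite /block_down -{1}(prednK d0).
  apply: (@ltn_find_iota (fun t => same_block f g i (i - t.+1%:Z))) => [{}t|].
    rewrite /same_block.
    have := af' (i - t.+1%:Z) i; have := af' (i - t.+2%:Z) (i - t.+1%:Z).
    have := ag' (i - t.+1%:Z) i; have := ag' (i - t.+2%:Z) (i - t.+1%:Z).
    lia.
  have := qf (i - d%:Z).
  by rewrite prednK // /same_block (_ : i - d%:Z + d%:Z = i); lia.
have [ij|] := ltrP i j.
  by have := upP `|j - i|%N.-1; rewrite (_ : i + _ = j); lia.
rewrite le_eqVlt => /orP [/eqP ->|ji].
  by rewrite /same_block !eqxx; lia.
by have := dnP `|i - j|%N.-1; rewrite (_ : i - _ = j); lia.
Qed.

Lemma same_block_rev d L f g : (0 < d)%N -> (0 < L)%N ->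
  quasi_periodic d L f -> antitone f -> antitone g ->
  forall i, same_block f g i (block_rev d f g i).
Proof.
move=> d0 L0 qf af ag i; rewrite (same_blockP d0 L0 qf af ag) /block_rev; lia.
Qed.

(** A point and its mirror image add up to the sum of the two endpoints, which is the same all over
    the block. *)
Lemma block_rev_same d L f g : (0 < d)%N -> (0 < L)%N ->
  quasi_periodic d L f -> antitone f -> antitone g ->
  forall i j, same_block f g i j ->
  block_rev d f g j = block_rev d f g i + i - j.
Proof.
move=> d0 L0 qf af ag i j sij; have sP := same_blockP d0 L0 qf af ag.
have sE k : same_block f g i k = same_block f g j k.
  by move: sij; rewrite /same_block => /andP [/eqP -> /eqP ->].
have := sij; rewrite /block_rev.
have := sE (i + (block_up d f g i)%:Z); have := sE (i - (block_down d f g i)%:Z).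
have := sE (j + (block_up d f g j)%:Z); have := sE (j - (block_down d f g j)%:Z).
rewrite !sP; lia.
Qed.

Lemma block_revK d L f g : (0 < d)%N -> (0 < L)%N ->
  quasi_periodic d L f -> antitone f -> antitone g ->
  involutive (block_rev d f g).
Proof.
move=> d0 L0 qf af ag i.
rewrite (block_rev_same d0 L0 qf af ag (same_block_rev d0 L0 qf af ag i)); lia.
Qed.

Definition local_swap (d L : nat) (l x m : seq int) : seq int :=
  let f := ext d L l in let g := ext d L m in
  mkseq (fun i => f i%:Z + g i%:Z - ext d L x (block_rev d f g i%:Z)) d.

Lemma local_swapC d L l x m : local_swap d L l x m = local_swap d L m x l.
Proof.
by apply: eq_map => i; rewrite block_revC [X in X - _]addrC.
Qed.

(** The block reversal commutes with the shift by [d], so the right-hand side drops by [L + L - L]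
    per period and is determined by its values on one period. *)
Lemma ext_local_swap d L l x m : (0 < d)%N ->
  ext d L (local_swap d L l x m) =1
  (fun z => ext d L l z + ext d L m z
            - ext d L x (block_rev d (ext d L l) (ext d L m) z)).
Proof.
move=> d0; have qe y := ext_quasi_periodic L y d0.
apply: (ext_mkseq (f := fun z => _ z + _ z - _ (block_rev _ _ _ z))) => // z.
by rewrite (block_revD (qe l) (qe m)) !qe; lia.
Qed.

Lemma size_local_swap d L l x m : size (local_swap d L l x m) = d.
Proof. exact: size_mkseq. Qed.

(** Both applications use the same block reversal, as [l] and [m] stay fixed. It is an involution
    that preserves the extensions of [l] and [m], so these cancel. *)
Lemma local_swapK d L l x m : (0 < d)%N -> (0 < L)%N ->
  dL_staircase d L l -> dL_staircase d L m -> size x = d ->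
  local_swap d L l (local_swap d L l x m) m = x.
Proof.
move=> d0 L0 /(dL_staircaseP _ _ d0) [_ al] /(dL_staircaseP _ _ d0) [_ am] sx.
have ql := ext_quasi_periodic L l d0.
apply: (@eq_from_nth _ 0); first by rewrite size_local_swap.
move=> i; rewrite size_local_swap => id; rewrite nth_mkseq // ext_local_swap //.
rewrite (block_revK d0 L0 ql al am) -(ext_nat L x id).
have /andP [/eqP <- /eqP <-] := same_block_rev d0 L0 ql al am i%:Z.
lia.
Qed.

(** The block reversal permutes the residues modulo [d], so it does not change the sum of a
    [d]-periodic function over a period. *)
Lemma stsize_local_swap d L l x m : (0 < d)%N -> (0 < L)%N ->
  dL_staircase d L l -> dL_staircase d L m -> size x = d ->
  stsize (local_swap d L l x m) = stsize l + stsize m - stsize x.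
Proof.
move=> d0 L0 /(dL_staircaseP _ _ d0) [sl al] /(dL_staircaseP _ _ d0) [sm am] sx.
have qe y := ext_quasi_periodic L y d0; have ql := qe l.
set s := block_rev d (ext d L l) (ext d L m).
(* The extension of [x] is only quasi-periodic; subtracting that of [l], which is constant on
   blocks, makes it periodic. *)
pose h z := ext d L x z - ext d L l z.
have hM (z k : int) : h (z + k * d%:Z) = h z.
  by rewrite /h !(quasi_periodicM (qe _)); lia.
have sM (z k : int) : s (z + k * d%:Z) = s z + k * d%:Z.
  rewrite /s; elim/int_ind: k => [|n IH|n IH].
  - by rewrite !mul0r !addr0.
  - have -> : z + n.+1%:Z * d%:Z = z + n%:Z * d%:Z + d%:Z by nia.
    rewrite (block_revD (qe l) (qe m)) IH; lia.
  - have := block_revD (qe l) (qe m) (z + - n.+1%:Z * d%:Z).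
    have -> : z + - n.+1%:Z * d%:Z + d%:Z = z + - n%:Z * d%:Z by nia.
    rewrite IH !mulNr => E; lia.
have sd (i : 'I_d) : {j : 'I_d | exists k : int, s i%:Z = j%:Z + k * d%:Z}.
  have md : (`|(s i%:Z %% d%:Z)%Z| < d)%N.
    have := ltz_pmod (s i%:Z) (_ : 0 < d%:Z).
    have := modz_ge0 (s i%:Z) (_ : d%:Z != 0); lia.
  exists (Ordinal md); exists (s i%:Z %/ d%:Z)%Z => /=.
  have := modz_ge0 (s i%:Z) (_ : d%:Z != 0); have := divz_eq (s i%:Z) d%:Z; lia.
pose p i := sval (sd i).
have pE (i : 'I_d) : exists k : int, s i%:Z = (p i)%:Z + k * d%:Z.
  exact: (svalP (sd i)).
have p_inj : injective p.
  move=> i j pij; have [k sk] := pE i; have [k' sk'] := pE j.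
  (* If [p i = p j], then [s i] and [s j] differ by [k - k'] periods; applying [s] again shows that
     [i] and [j] are congruent modulo [d]. *)
  have := sM (s j%:Z) (k - k').
  have -> : s j%:Z + (k - k') * d%:Z = s i%:Z by rewrite sk sk' pij; lia.
  rewrite /s !(block_revK d0 L0 ql al am) => ij.
  have /(congr1 (modz^~ d%:Z)) := ij.
  rewrite /= [j%:Z + _]addrC modzMDl !modz_small;
    try by (have := ltn_ord i; have := ltn_ord j; lia).
  by move=> [e]; exact: val_inj.
rewrite (stsize_ext L (size_local_swap d L l x m)).
rewrite (stsize_ext L sl) (stsize_ext L sm) (stsize_ext L sx).
suff: \sum_(i < d) h i%:Z = \sum_(i < d) h (s i%:Z).
  rewrite -big_split -sumrB => /= H.
  under eq_bigr => i _ do rewrite ext_local_swap //.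
  have -> : \sum_(i < d) (ext d L l i + ext d L m i - ext d L x (s i)) =
     \sum_(i < d) (ext d L m i%:Z - h (s i%:Z)).
    apply: eq_bigr => i _.
    have /andP [/eqP e _] := same_block_rev d0 L0 ql al am i%:Z.
    by rewrite /h -e; lia.
  by rewrite sumrB -H -sumrB; apply: eq_bigr => i _; rewrite /h; lia.
rewrite (reindex_inj p_inj); apply: eq_bigr => i _.
by have [k ->] := pE i; rewrite hM.
Qed.

(** Here [c] is 0 if [x] lies above [l] and [m], and -1 if it lies below. Inside a block the
    reversal makes the subtracted term increase. Between blocks one of [l], [m] drops, and the new
    value lies between that staircase minus [c + 1] and that staircase minus [c], so a drop of at
    least 1 is enough. *)
Lemma dL_staircase_local_swap d L l x m (c : int) : (0 < d)%N -> (0 < L)%N ->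
  dL_staircase d L l -> dL_staircase d L x -> dL_staircase d L m ->
  (forall z, c <= ext d L x z - ext d L l z <= c + 1) ->
  (forall z, c <= ext d L x z - ext d L m z <= c + 1) ->
  dL_staircase d L (local_swap d L l x m).
Proof.
move=> d0 L0 /(dL_staircaseP _ _ d0) [_ al] /(dL_staircaseP _ _ d0) [_ ax].
move=> /(dL_staircaseP _ _ d0) [_ am] lx mx.
have ql := ext_quasi_periodic L l d0.
apply/dL_staircaseP => //; split; first exact: size_local_swap.
move=> z; rewrite !ext_local_swap //.
have [b|] := boolP (same_block (ext d L l) (ext d L m) z (z + 1)).
  rewrite (block_rev_same d0 L0 ql al am b).
  case/andP: b => /eqP <- /eqP <-.
  have -> a : a + z - (z + 1) = a - 1 by lia.
  have := ax (block_rev d (ext d L l) (ext d L m) z - 1).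
  by rewrite subrK lerD2l lerN2.
rewrite /same_block; have := al z; have := am z.
have sE := same_block_rev d0 L0 ql al am.
have /andP [/eqP e1 /eqP e2] := sE z; have /andP [/eqP e3 /eqP e4] := sE (z + 1).
have := lx (block_rev d (ext d L l) (ext d L m) z).
have := lx (block_rev d (ext d L l) (ext d L m) (z + 1)).
have := mx (block_rev d (ext d L l) (ext d L m) z).
have := mx (block_rev d (ext d L l) (ext d L m) (z + 1)).
rewrite -e1 -e2 -e3 -e4; lia.
Qed.

(** With [t] the mirror image of [z], the strip conditions between the new staircase and [l], [m]
    become the known ones between [x] and [m], [l]. *)
Lemma local_swap_step d L l x m : (0 < d)%N -> (0 < L)%N ->
  dL_staircase d L l -> dL_staircase d L m ->
  forall z, exists2 t,
    ext d L l z - ext d L (local_swap d L l x m) z = ext d L x t - ext d L m t &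
    ext d L m z - ext d L (local_swap d L l x m) z = ext d L x t - ext d L l t.
Proof.
move=> d0 L0 /(dL_staircaseP _ _ d0) [_ al] /(dL_staircaseP _ _ d0) [_ am] z.
exists (block_rev d (ext d L l) (ext d L m) z); rewrite ext_local_swap //;
  have /andP [/eqP e1 /eqP e2] :=
    same_block_rev d0 L0 (ext_quasi_periodic L l d0) al am z;
  rewrite -?e1 -?e2; lia.
Qed.

Lemma precdL_local_swap_down d L l x m : (0 < d)%N -> (0 < L)%N ->
  precdL d L l x -> precdL d L m x ->
  precdL d L (local_swap d L l x m) l /\ precdL d L (local_swap d L l x m) m.
Proof.
move=> d0 L0 /(precdLP _ _ _ d0) [sl sx lx] /(precdLP _ _ _ d0) [sm _ mx].
have sS : dL_staircase d L (local_swap d L l x m).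
  by apply: (@dL_staircase_local_swap _ _ _ _ _ 0).
split; apply/precdLP => //; split=> // z;
  by have [t e1 e2] := local_swap_step x d0 L0 sl sm z; rewrite ?e1 ?e2.
Qed.

Lemma precdL_local_swap_up d L l x m : (0 < d)%N -> (0 < L)%N ->
  precdL d L x l -> precdL d L x m ->
  precdL d L l (local_swap d L l x m) /\ precdL d L m (local_swap d L l x m).
Proof.
move=> d0 L0 /(precdLP _ _ _ d0) [sx sl lx] /(precdLP _ _ _ d0) [_ sm mx].
have sS : dL_staircase d L (local_swap d L l x m).
  apply: (@dL_staircase_local_swap _ _ _ _ _ (-1)) => // z.
    by have := lx z; lia.
  by have := mx z; lia.
split; apply/precdLP => //; split=> // z;
  have [t e1 e2] := local_swap_step x d0 L0 sl sm z;
  [have := mx t | have := lx t]; move: e1 e2; lia.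
Qed.

(** * Swapping adjacent letters *)

Lemma eqn_false (a b : nat) : a <> b -> (a == b) = false.
Proof. by move/eqP/negbTE. Qed.

Definition swap_word (i : nat) (w : tword) : tword :=
  set_nth false (set_nth false w i (nth false w i.+1)) i.+1 (nth false w i).

(** Letter [i] leads from entry [i] to entry [i.+1], so exchanging letters [i] and [i.+1] changes
    only the entry between them. *)
Definition swap_tab (d L i : nat) (T : seq (seq int)) : seq (seq int) :=
  set_nth [::] T i.+1
    (local_swap d L (nth [::] T i) (nth [::] T i.+1) (nth [::] T i.+2)).

(** Unlike [descent], this condition survives the swap at [i], so it also covers undoing a swap. *)
Definition adjacent_neq (w : tword) (i : nat) : bool :=
  (i.+1 < size w)%N && (nth false w i != nth false w i.+1).

Definition descent (w : tword) (i : nat) : bool :=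
  [&& (i.+1 < size w)%N, nth false w i & ~~ nth false w i.+1].

Lemma descent_adjacent_neq w i : descent w i -> adjacent_neq w i.
Proof. by case/and3P=> iw wi wi1; rewrite /adjacent_neq iw wi (negbTE wi1). Qed.

Lemma nth_swap_word i w j : nth false (swap_word i w) j =
  if j == i.+1 then nth false w i else
  if j == i then nth false w i.+1 else nth false w j.
Proof. by rewrite nth_set_nth /= nth_set_nth. Qed.

Lemma size_swap_word i w : (i.+1 < size w)%N -> size (swap_word i w) = size w.
Proof. by move=> iw; rewrite !size_set_nth; lia. Qed.

Lemma nth_swap_tab d L i T j : nth [::] (swap_tab d L i T) j =
  if j == i.+1
  then local_swap d L (nth [::] T i) (nth [::] T i.+1) (nth [::] T i.+2)
  else nth [::] T j.
Proof. exact: nth_set_nth. Qed.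

Lemma size_swap_tab d L i T :
  (i.+1 < size T)%N -> size (swap_tab d L i T) = size T.
Proof. by move=> iT; rewrite size_set_nth; lia. Qed.

Lemma swap_wordK i w : (i.+1 < size w)%N -> swap_word i (swap_word i w) = w.
Proof.
move=> iw; apply: (@eq_from_nth _ false); first by rewrite !size_swap_word.
move=> j _; rewrite !nth_swap_word !eqxx.
rewrite (_ : i == i.+1 = false); last by lia.
by case: eqP => [-> //|_]; case: eqP => [->|].
Qed.

Lemma adjacent_neq_swap w i :
  adjacent_neq w i -> adjacent_neq (swap_word i w) i.
Proof.
case/andP=> iw nw; rewrite /adjacent_neq size_swap_word // iw /=.
by rewrite !nth_swap_word !eqxx (_ : i == i.+1 = false) 1?eq_sym //; lia.
Qed.

Lemma swap_wordC w i j : (j.+1 < size w)%N -> (i.+1 < j)%N ->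
  swap_word i (swap_word j w) = swap_word j (swap_word i w).
Proof.
move=> jw ij; apply: (@eq_from_nth _ false).
  by rewrite !size_swap_word ?size_swap_word //; lia.
move=> k _; rewrite !nth_swap_word.
by do ![case: eqP => ?] => //; lia.
Qed.

(** The swap at [i] reads entries [i] to [i.+2] and writes only [i.+1]. For [j = i.+2] both swaps
    read entry [j], but neither writes it. *)
Lemma swap_tabC d L T i j : (i.+1 < j)%N ->
  swap_tab d L i (swap_tab d L j T) = swap_tab d L j (swap_tab d L i T).
Proof.
move=> ij; rewrite {1 3}/swap_tab !nth_swap_tab.
rewrite !eqn_false; try lia.
by rewrite /swap_tab set_set_nth eqn_false //; lia.
Qed.

(** For [j = i.+1] the letter at [j] would be both [-] and [+]. *)
Lemma descent_disjoint w i j :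
  descent w i -> descent w j -> (i < j)%N -> (i.+1 < j)%N.
Proof.
case/and3P=> _ _ wi /and3P [_ wj _]; rewrite leq_eqVlt => /orP [/eqP e|//].
by rewrite e wj in wi.
Qed.

Lemma descent_swap_far w i j : (i.+1 < size w)%N ->
  (i.+1 < j)%N || (j.+1 < i)%N -> descent (swap_word i w) j = descent w j.
Proof.
move=> iw ij; rewrite /descent size_swap_word // !nth_swap_word.
by rewrite !eqn_false //; lia.
Qed.

(** * Confluence of sorting *)

Definition swap_step (d L : nat) (x y : tword * seq (seq int)) : Prop :=
  exists2 i, descent x.1 i & y = (swap_word i x.1, swap_tab d L i x.2).

Fixpoint swap_steps (d L k : nat) (x y : tword * seq (seq int)) : Prop :=
  if k is k'.+1 then exists2 z, swap_step d L x z & swap_steps d L k' z y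
  else x = y.

Lemma swap_step_diamond d L x y z : swap_step d L x y -> swap_step d L x z ->
  y = z \/ exists2 t, swap_step d L y t & swap_step d L z t.
Proof.
have H i j : descent x.1 i -> descent x.1 j -> (i < j)%N ->
    exists2 t, swap_step d L (swap_word i x.1, swap_tab d L i x.2) t
             & swap_step d L (swap_word j x.1, swap_tab d L j x.2) t.
  move=> di dj lij; have ij := descent_disjoint di dj lij.
  have /and3P [iw _ _] := di; have /and3P [jw _ _] := dj.
  exists (swap_word j (swap_word i x.1), swap_tab d L j (swap_tab d L i x.2)).
    by exists j => //=; rewrite descent_swap_far // ij.
  exists i => /=; first by rewrite descent_swap_far // ij orbT.
  by rewrite /= (swap_wordC jw ij) (swap_tabC _ _ _ ij).
case=> i di -> [j dj ->]; have [ij|ji|->] := ltngtP i j; last by left.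
  by right; apply: H.
by right; have [t ? ?] := H _ _ dj di ji; exists t.
Qed.

Definition sorted_word (w : tword) : Prop := forall i, ~~ descent w i.

(** By the diamond property, a path to a normal form may be rerouted through any chosen first step
    without changing its length. *)
Lemma swap_steps_pred d L k x y n : swap_steps d L k x n -> sorted_word n.1 ->
  swap_step d L x y -> exists2 k', k = k'.+1 & swap_steps d L k' y n.
Proof.
elim: k x y => [|k IH] x y.
  by move=> /= -> sn [i di _]; have := sn i; rewrite di.
case=> z xz zn sn xy; exists k => //.
have [-> //|[t yt zt]] := swap_step_diamond xy xz.
by have [k' -> tn] := IH _ _ zn sn zt; exists t.
Qed.

Lemma swap_steps_unique d L k k' x n n' :
  swap_steps d L k x n -> sorted_word n.1 ->
  swap_steps d L k' x n' -> sorted_word n'.1 -> n = n'.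
Proof.
elim: k' k x => [|k' IH] k x xn sn.
  case: k xn => [|k] /=; first by move=> <- <-.
  by move=> [z [i di _] _] <- sx; have := sx i; rewrite di.
(* The first path is rerouted to share the initial step of the second. *)
case=> y xy yn' sn'; have [k1 _ yn] := swap_steps_pred xn sn xy.
exact: IH yn sn yn' sn'.
Qed.

(** * Sequences of swaps and an explicit sorting sequence *)

Definition swaps_word (p : seq nat) (w : tword) : tword :=
  foldl (fun w i => swap_word i w) w p.

Definition swaps_tab (d L : nat) (p : seq nat) (T : seq (seq int)) :=
  foldl (fun T i => swap_tab d L i T) T p.

(** [foldr] applies the last swap of [p] first; as swaps of unequal letters are involutions on
    tableaux, this undoes [swaps_tab d L p]. *)
Definition unswaps_tab (d L : nat) (p : seq nat) (T : seq (seq int)) :=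
  foldr (swap_tab d L) T p.

Fixpoint descents (p : seq nat) (w : tword) : bool :=
  if p is i :: p' then descent w i && descents p' (swap_word i w) else true.

Lemma descents_cat p q w :
  descents (p ++ q) w = descents p w && descents q (swaps_word p w).
Proof. by elim: p w => //= i p IH w; rewrite IH andbA. Qed.

Lemma swaps_word_cat p q w :
  swaps_word (p ++ q) w = swaps_word q (swaps_word p w).
Proof. exact: foldl_cat. Qed.

Lemma descents_map p b w : descents (map S p) (b :: w) = descents p w.
Proof. by elim: p w => //= i p IH w; rewrite -IH. Qed.

Lemma swaps_word_map p b w :
  swaps_word (map S p) (b :: w) = b :: swaps_word p w.
Proof. by elim: p w => //= i p IH w; rewrite -IH. Qed.

Lemma bubble m r :
  descents (iota 0 m) (true :: nseq m false ++ r) /\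
  swaps_word (iota 0 m) (true :: nseq m false ++ r)
    = nseq m false ++ true :: r.
Proof.
elim: m => //= m [IH1 IH2]; rewrite -[1%N]/(1 + 0)%N iotaDl.
by rewrite -[map _ _]/(map S _) descents_map swaps_word_map IH1 IH2.
Qed.

(** Insertion sort: the tail is sorted first, with indices shifted by one, and then a leading [+]
    moves right past all the [-]. *)
Fixpoint sorting (w : tword) : seq nat :=
  if w is b :: w' then
    map S (sorting w') ++ (if b then iota 0 (count negb w') else [::])
  else [::].

Lemma sortingP w : descents (sorting w) w /\
  swaps_word (sorting w) w = nseq (count negb w) false ++ nseq (count id w) true.
Proof.
elim: w => //= b w [IH1 IH2].
rewrite descents_cat swaps_word_cat descents_map swaps_word_map IH1 IH2 /=.
by case: b => //=; have [-> ->] := bubble (count negb w) (nseq (count id w) true).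
Qed.

Lemma sorted_nseq m n : sorted_word (nseq m false ++ nseq n true).
Proof.
move=> i; rewrite /descent size_cat !nth_cat !size_nseq !nth_nseq.
by do ![case: ifP => //=] => *; lia.
Qed.

Lemma swap_steps_descents d L p w T : descents p w ->
  swap_steps d L (size p) (w, T) (swaps_word p w, swaps_tab d L p T).
Proof.
elim: p w T => //= i p IH w T /andP [di dp].
by exists (swap_word i w, swap_tab d L i T); [exists i | exact: IH].
Qed.

(** * Sorting and reversal *)

Lemma size_tstar w : size (tstar w) = size w.
Proof. by rewrite size_rev size_map. Qed.

Lemma nth_tstar w i : (i < size w)%N ->
  nth false (tstar w) i = ~~ nth false w (size w - i.+1).
Proof.
move=> iw; rewrite nth_rev ?size_map // (nth_map false) //; lia.
Qed.

Lemma tstar_swap_word w i : (i.+1 < size w)%N ->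
  tstar (swap_word i w) = swap_word (size w - i.+2) (tstar w).
Proof.
move=> iw; apply: (@eq_from_nth _ false).
  by rewrite [RHS]size_swap_word !size_tstar ?size_swap_word //; lia.
move=> j; rewrite size_tstar size_swap_word // => jw.
rewrite nth_tstar size_swap_word // !nth_swap_word.
rewrite !nth_tstar; try lia.
do ![case: eqP => ?]; congr (~~ nth _ _ _); lia.
Qed.

(** Reversal interchanges the two neighbours of the changed entry, which [local_swapC] allows. A
    tableau has one entry more than its word has letters, so [size T - i.+3] is the index
    [size w - i.+2] of [tstar_swap_word]. *)
Lemma rev_swap_tab d L i T : (i.+2 < size T)%N ->
  rev (swap_tab d L i T) = swap_tab d L (size T - i.+3) (rev T).
Proof.
move=> iT; apply: (@eq_from_nth _ [::]).
  by rewrite [RHS]size_swap_tab !size_rev ?size_swap_tab //; lia.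
move=> j; rewrite size_rev size_swap_tab => [jT|]; last by lia.
rewrite nth_rev ?size_swap_tab //; try lia.
rewrite !nth_swap_tab !nth_rev; try lia.
rewrite local_swapC.
do ![case: eqP => ?]; try lia; last by [].
by congr (local_swap _ _ (nth _ _ _) (nth _ _ _) (nth _ _ _)); lia.
Qed.

(** The factor [+-] is fixed by reversing it and interchanging the signs. *)
Lemma descent_tstar w i : (i.+1 < size w)%N ->
  descent (tstar w) (size w - i.+2) = descent w i.
Proof.
move=> iw; rewrite /descent size_tstar !nth_tstar; try lia.
rewrite negbK (_ : size w - (size w - i.+2).+1 = i.+1)%N; last by lia.
rewrite (_ : size w - (size w - i.+2).+2 = i)%N; last by lia.
by rewrite [_ && nth _ _ _]andbC (_ : _ < _)%N; lia.
Qed.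

Lemma swap_steps_rev d L k w T n N : size T = (size w).+1 ->
  swap_steps d L k (w, T) (n, N) ->
  swap_steps d L k (tstar w, trev T) (tstar n, trev N).
Proof.
elim: k w T => [|k IH] w T sT; first by case=> -> ->.
case=> _ [i /= di ->] H; have /and3P [iw _ _] := di.
exists (tstar (swap_word i w), trev (swap_tab d L i T)).
  exists (size w - i.+2)%N; first by rewrite descent_tstar.
  rewrite /= tstar_swap_word // /trev rev_swap_tab ?sT //.
by apply: IH => //; rewrite size_swap_tab ?size_swap_word ?sT //; lia.
Qed.

Lemma tstar_nseq m n : tstar (nseq m false ++ nseq n true) =
  nseq n false ++ nseq m true.
Proof.
rewrite /tstar map_cat rev_cat !map_nseq.
have rn k (b : bool) : rev (nseq k b) = nseq k b.
  by elim: k => //= k IH; rewrite rev_cons IH; elim: k {IH} => //= k ->.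
by rewrite !rn.
Qed.

(** The mirror image of the sorting path of [w] sorts [tstar w], in general by another order of
    swaps; uniqueness of the normal form identifies the results. *)
Lemma swaps_tab_rev d L w T : size T = (size w).+1 ->
  swaps_tab d L (sorting (tstar w)) (trev T)
  = trev (swaps_tab d L (sorting w) T).
Proof.
move=> sT; have [dw nw] := sortingP w; have [dv nv] := sortingP (tstar w).
have H1 := swap_steps_descents d L (trev T) dv.
have H2 := swap_steps_rev sT (swap_steps_descents d L T dw).
have sv : sorted_word (swaps_word (sorting (tstar w)) (tstar w)).
  by rewrite nv; apply: sorted_nseq.
have sw : sorted_word (tstar (swaps_word (sorting w) w)).
  by rewrite nw tstar_nseq; apply: sorted_nseq.
by case: (swap_steps_unique H1 sv H2 sw).
Qed.

(** * Swaps of tableaux *)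

Lemma is_tableau_adjacent d L w T i : (0 < d)%N ->
  is_tableau d L w T -> adjacent_neq w i ->
  let l := nth [::] T i in let x := nth [::] T i.+1 in
  let m := nth [::] T i.+2 in
  [/\ dL_staircase d L l, dL_staircase d L m, size x = d &
      if nth false w i then precdL d L l x /\ precdL d L m x
      else precdL d L x l /\ precdL d L x m].
Proof.
move=> d0 [sT [st pr]] /andP [iw nw] l x m.
have := pr i (ltnW iw); have := pr i.+1 iw.
have /andP [/eqP sxd _] : staircase d x by apply: st; lia.
move: nw; rewrite -/l -/x -/m; case: (nth _ w i); case: (nth _ w i.+1) => // _;
  by move=> /[dup] H1 /and3P [? ? _] /[dup] H2 /and3P [? ? _].
Qed.

Lemma swap_tabK d L w T i : (0 < d)%N -> (0 < L)%N ->
  is_tableau d L w T -> adjacent_neq w i -> swap_tab d L i (swap_tab d L i T) = T.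
Proof.
move=> d0 L0 tT wi; have [sl sm sx _] := is_tableau_adjacent d0 tT wi.
have [sT _] := tT; have /andP [iw _] := wi.
have iT : (i.+1 < size T)%N by lia.
apply: (@eq_from_nth _ [::]) => [|j _]; first by rewrite !size_swap_tab.
rewrite !nth_swap_tab eqxx (@eqn_false i) ?(@eqn_false i.+2); try lia.
by case: eqP => // ->; rewrite local_swapK.
Qed.

Lemma is_tableau_swap d L w T i : (0 < d)%N -> (0 < L)%N ->
  is_tableau d L w T -> adjacent_neq w i ->
  is_tableau d L (swap_word i w) (swap_tab d L i T).
Proof.
move=> d0 L0 tT wi; have [_ _ _] := is_tableau_adjacent d0 tT wi.
have [sT [st pr]] := tT; have /andP [iw nw] := wi.
set l := nth _ T i; set x := nth _ T i.+1; set m := nth _ T i.+2 => H.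
have K : if nth false w i
    then precdL d L (local_swap d L l x m) l /\ precdL d L (local_swap d L l x m) m
    else precdL d L l (local_swap d L l x m) /\ precdL d L m (local_swap d L l x m).
  move: H; case: (nth _ w i) => [] [H1 H2].
    exact: precdL_local_swap_down.
  exact: precdL_local_swap_up.
split; first by rewrite size_swap_tab ?size_swap_word ?sT; lia.
split=> j.
  rewrite size_swap_tab ?sT; last by lia.
  move=> jT; rewrite nth_swap_tab; case: eqP => _; last by apply: st; rewrite sT.
  by move: K; case: (nth _ w i) => [] [/and3P [/andP [? _] /andP [? _] _] _].
rewrite size_swap_word // => jw; rewrite nth_swap_word !nth_swap_tab eqSS.
case: (j =P i.+1) => [->|ji1].
  rewrite (_ : i.+1 == i = false); last by lia.
  by rewrite -/l -/x -/m; move: K; case: (nth _ w i) => [] [].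
case: (j =P i) => [->|ji]; last exact: pr.
rewrite -/l -/x -/m; move: K nw.
by case: (nth _ w i); case: (nth _ w i.+1) => // [] [].
Qed.

Lemma eq_in_map_filter (A : eqType) B (p q : pred A) (f g : A -> B) s :
  {in s, p =1 q} -> {in s, f =1 g} ->
  [seq f x | x <- s & p x] = [seq g x | x <- s & q x].
Proof.
move=> pq fg; rewrite (eq_in_filter pq); apply/eq_in_map => x.
by rewrite mem_filter => /andP [_ /fg].
Qed.

(** Treats both weights at once, with [p] selecting the sign. Just one of the letters [i], [i.+1] is
    selected; the two equations on [F] say that its contribution moves along with it, to the right
    or to the left. *)
Lemma swap_map_filter d L w T i (p : pred bool) (F : seq int -> seq int -> int) :
  (i.+1 < size w)%N -> p (nth false w i) != p (nth false w i.+1) ->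
  let l := nth [::] T i in let x := nth [::] T i.+1 in
  let m := nth [::] T i.+2 in
  F (local_swap d L l x m) m = F l x -> F l (local_swap d L l x m) = F x m ->
  let w' := swap_word i w in let T' := swap_tab d L i T in
  [seq F (nth [::] T' j) (nth [::] T' j.+1)
  | j <- iota 0 (size w') & p (nth false w' j)] =
  [seq F (nth [::] T j) (nth [::] T j.+1)
  | j <- iota 0 (size w) & p (nth false w j)].
Proof.
move=> iw np l x m F1 F2 w' T'; rewrite size_swap_word //.
(* The positions split into those before [i], the pair [i], [i.+1], and the rest; outside the pair
   nothing changes. *)
have -> : size w = (i + (size w - i.+2).+2)%N by lia.
rewrite iotaD !filter_cat !map_cat; congr (_ ++ _).
  apply: eq_in_map_filter => j; rewrite mem_iota => ij.
    by rewrite nth_swap_word !eqn_false //; lia.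
  by rewrite !nth_swap_tab !eqn_false //; lia.
rewrite add0n [iota i _]/=.
have R : [seq F (nth [::] T' j) (nth [::] T' j.+1)
         | j <- iota i.+2 (size w - i.+2) & p (nth false w' j)] =
         [seq F (nth [::] T j) (nth [::] T j.+1)
         | j <- iota i.+2 (size w - i.+2) & p (nth false w j)].
  apply: eq_in_map_filter => j; rewrite mem_iota => ij.
    by rewrite nth_swap_word !eqn_false //; lia.
  by rewrite !nth_swap_tab !eqn_false //; lia.
rewrite /= !nth_swap_word !eqxx eqn_false; last by lia.
move: np; case: (p (nth _ w i)); case: (p (nth _ w i.+1)) => // _ /=;
  rewrite R !nth_swap_tab !eqxx !eqn_false; try lia.
  by rewrite -/l -/m -/x F1.
by rewrite -/l -/m -/x F2.
Qed.

Definition tableau_data (w : tword) (T : seq (seq int)) :=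
  (inner_shape T, outer_shape T, wt_plus w T, wt_minus w T).

(** The changed entry is neither first nor last, and [stsize_local_swap] says that the two step
    sizes around it trade places. *)
Lemma tableau_data_swap d L w T i : (0 < d)%N -> (0 < L)%N ->
  is_tableau d L w T -> adjacent_neq w i ->
  tableau_data (swap_word i w) (swap_tab d L i T) = tableau_data w T.
Proof.
move=> d0 L0 tT wi; have [sl sm sx _] := is_tableau_adjacent d0 tT wi.
have [sT _] := tT; have /andP [iw nw] := wi.
have sD := stsize_local_swap d0 L0 sl sm sx.
rewrite /tableau_data; congr (_, _, _, _).
- by rewrite /inner_shape nth_swap_tab.
- rewrite /outer_shape -!nth_last size_swap_tab ?nth_swap_tab; last by lia.
  by case: eqP => //; lia.
- by apply: (@swap_map_filter _ _ _ _ _ id (fun a b => stsize b - stsize a));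
    rewrite ?sD //; lia.
congr rev.
apply: (@swap_map_filter _ _ _ _ _ negb (fun a b => stsize a - stsize b)) => //;
  rewrite ?sD; first by move: nw; do 2 case: (nth _ _ _).
  lia.
lia.
Qed.

Lemma swaps_tabP d L p w T : (0 < d)%N -> (0 < L)%N ->
  is_tableau d L w T -> descents p w ->
  [/\ is_tableau d L (swaps_word p w) (swaps_tab d L p T),
      unswaps_tab d L p (swaps_tab d L p T) = T &
      tableau_data (swaps_word p w) (swaps_tab d L p T) = tableau_data w T].
Proof.
move=> d0 L0; elim: p w T => //= i p IH w T tT /andP [/descent_adjacent_neq di dp].
have [H1 -> ->] := IH _ _ (is_tableau_swap d0 L0 tT di) dp.
by rewrite (swap_tabK d0 L0 tT di) tableau_data_swap.
Qed.

Lemma unswaps_tabP d L p w S : (0 < d)%N -> (0 < L)%N ->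
  descents p w -> is_tableau d L (swaps_word p w) S ->
  is_tableau d L w (unswaps_tab d L p S) /\
  swaps_tab d L p (unswaps_tab d L p S) = S.
Proof.
move=> d0 L0; elim: p w => //= i p IH w /andP [/descent_adjacent_neq di dp] tS.
have [H1 H2] := IH _ dp tS; have ai := adjacent_neq_swap di.
rewrite (swap_tabK d0 L0 H1 ai); split=> //.
(* Writing [w] as a swap of [swap_word i w] turns undoing into another application of
   [is_tableau_swap]. *)
have /andP [iw _] := di; rewrite -[w](swap_wordK iw).
exact: is_tableau_swap.
Qed.

Lemma is_tableau_rev d L w T :
  is_tableau d L w T -> is_tableau d L (tstar w) (trev T).
Proof.
case=> sT [st pr]; split; first by rewrite size_rev size_tstar.
split=> i; rewrite ?size_tstar ?size_rev => iT.
  by rewrite nth_rev //; apply: st; lia.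
rewrite nth_tstar // /trev !nth_rev ?sT; try lia.
have /pr : (size w - i.+1 < size w)%N by lia.
rewrite (_ : (size w).+1 - i.+2 = size w - i.+1)%N; last by lia.
rewrite (_ : (size w).+1 - i.+1 = (size w - i.+1).+1)%N; last by lia.
by case: (nth _ w _).
Qed.

(** * The bijection by sorting and unsorting *)

Theorem theorem8p9 (d L : nat) (hd : (0 < d)%N) (hL : (0 < L)%N) :
  exists Psi : tword -> tword -> seq (seq int) -> seq (seq int),
    forall w v : tword,
      count id w = count id v -> count negb w = count negb v ->
      [/\ (forall T, is_tableau d L w T -> is_tableau d L v (Psi w v T)),
          (forall T1 T2, is_tableau d L w T1 -> is_tableau d L w T2 ->
             Psi w v T1 = Psi w v T2 -> T1 = T2),
          (forall S, is_tableau d L v S ->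
             exists T, is_tableau d L w T /\ Psi w v T = S),
          (forall T, is_tableau d L w T ->
             [/\ inner_shape (Psi w v T) = inner_shape T,
                 outer_shape (Psi w v T) = outer_shape T,
                 wt_plus v (Psi w v T) = wt_plus w T &
                 wt_minus v (Psi w v T) = wt_minus w T]) &
          (forall T, is_tableau d L w T ->
             Psi (tstar w) (tstar v) (trev T) = trev (Psi w v T))].
Proof.
exists (fun w v T =>
  unswaps_tab d L (sorting v) (swaps_tab d L (sorting w) T)).
move=> w v cid cneg.
have [dw nw] := sortingP w; have [dv nv] := sortingP v.
(* Equal letter counts give [w] and [v] the same sorted word, the common type at which the two
   sortings meet. *)
have nwv : swaps_word (sorting w) w = swaps_word (sorting v) v.
  by rewrite nw nv cid cneg.
have main T (tT : is_tableau d L w T) :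
    let S := unswaps_tab d L (sorting v) (swaps_tab d L (sorting w) T) in
    [/\ is_tableau d L v S, tableau_data v S = tableau_data w T &
        swaps_tab d L (sorting v) S = swaps_tab d L (sorting w) T].
  move=> S; have [H1 _ H2] := swaps_tabP hd hL tT dw.
  rewrite nwv in H1 H2; have [H3 H4] := unswaps_tabP hd hL dv H1.
  have [_ _ H5] := swaps_tabP hd hL H3 dv.
  by split=> //; rewrite -H5 H4 H2.
split.
- by move=> T /main [].
- move=> T1 T2 t1 t2 /(congr1 (swaps_tab d L (sorting v))).
  have [_ _ ->] := main _ t1; have [_ _ ->] := main _ t2.
  move/(congr1 (unswaps_tab d L (sorting w))).
  have [_ -> _] := swaps_tabP hd hL t1 dw.
  by have [_ -> _] := swaps_tabP hd hL t2 dw.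
- move=> S tS; have [H1 H2 _] := swaps_tabP hd hL tS dv.
  rewrite -nwv in H1; have [H3 H4] := unswaps_tabP hd hL dw H1.
  by eexists; split; [exact: H3 | rewrite H4].
- by move=> T /main [_ [-> -> -> ->] _].
- move=> T tT; have := main T tT; set S := unswaps_tab _ _ _ _ => - [tS _ eS].
  have [sT _] := tT; have [sS _] := tS.
  (* [S] and [T] sort to the same tableau, hence so do their reversals; unsorting to [tstar v] then
     returns the reversal of [S]. *)
  rewrite swaps_tab_rev // -eS -swaps_tab_rev //.
  have [dv' _] := sortingP (tstar v).
  by have [_ -> _] := swaps_tabP hd hL (is_tableau_rev tS) dv'.
Qed.
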